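(* Let $\mathcal{D}=(D,<,\approx)$, where $D$ is an infinite set, $<$ is a strict total order on $D$, and $\approx$ is equality. Then the satisfiability problem for $\mathrm{CLRV}^{\mathrm{XF},\mathrm{XF}^{-1},\mathrm{int}}(\mathcal{D})$ is undecidable.
   Context: The variable set is $V=V_{\mathrm{local}}\uplus V_{\mathrm{remote}}$, a disjoint union of local and remote variables. $\mathrm{CLRV}^{\mathrm{XF},\mathrm{XF}^{-1},\mathrm{int}}(\mathcal{D})$ formulas are given by the grammar $\phi ::= x_{loc}\approx \mathbf{X}^i y_{loc} \mid x_{loc}< \mathbf{X}^i y_{loc} \mid x_{rem}\approx \mathbf{X}^i y_{rem} \mid x_{rem}\approx \mathbf{XF}\, y_{rem} \mid x_{rem}\approx \mathbf{XF}^{-1} y_{rem} \mid x_{loc}\approx y_{rem} \mid \phi\wedge\phi \mid \neg\phi \mid \mathbf{X}\phi \mid \phi\mathbf{U}\phi \mid \mathbf{X}^{-1}\phi \mid \phi\mathbf{S}\phi$. Here $x_{loc},y_{loc}\in V_{\mathrm{local}}$, $x_{rem},y_{rem}\in V_{\mathrm{remote}}$ and $i\in\mathbb{N}$. A model is an infinite sequence $\sigma$ of maps $V\to D$, with the following semantics. - $\sigma,i\models x\approx\mathbf{X}^jy$ iff $\sigma(i)(x)=\sigma(i+j)(y)$. - $\sigma,i\models x<\mathbf{X}^jy$ iff $\sigma(i)(x)<\sigma(i+j)(y)$. - $\sigma,i\models x\approx\mathbf{XF}y$ iff there is $j>i$ with $\sigma(i)(x)=\sigma(j)(y)$. - $\sigma,i\models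 x\approx\mathbf{XF}^{-1}y$ iff there is $0\le j<i$ with $\sigma(i)(x)=\sigma(j)(y)$. - $\sigma,i\models x_{loc}\approx y_{rem}$ iff $\sigma(i)(x_{loc})=\sigma(i)(y_{rem})$; this is an equality between a local and a remote variable at the same position. - Boolean connectives and $\mathbf{X},\mathbf{U}$ are as in LTL. - $\sigma,i\models\mathbf{X}^{-1}\phi$ iff $i\ge1$ and $\sigma,i-1\models\phi$. - $\sigma,i\models\phi\mathbf{S}\phi'$ iff there is $j\le i$ with $\sigma,j\models\phi'$ and $\sigma,k\models\phi$ for all $j<k\le i$. The satisfiability problem asks, given a formula $\phi$, whether some model $\sigma$ satisfies $\sigma,0\models\phi$. *)

(* Defs.v *)
From Stdlib Require Import List Arith.
Import ListNotations.

(* Local variables and remote variables are both indexed by nat;        *)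
(* V = V_local (+) V_remote is their disjoint union.                    *)
Inductive form : Type :=
| LocEqX  (x : nat) (i : nat) (y : nat)
| LocLtX  (x : nat) (i : nat) (y : nat)
| RemEqX  (x : nat) (i : nat) (y : nat)
| RemXF   (x : nat) (y : nat)
| RemXFinv (x : nat) (y : nat)
| LocRem  (x : nat) (y : nat)
| FAnd (p q : form)
| FNeg (p : form)
| FNext (p : form)
| FUntil (p q : form)
| FPrev (p : form)
| FSince (p q : form).

(* A model: an infinite sequence of valuations V -> D, given as the pair  *)
(* of its local part and its remote part.                                 *)
Record model (D : Type) := Model {
  loc : nat -> nat -> D;   (* loc i x = sigma(i)(x_loc) *)
  rem : nat -> nat -> D    (* rem i x = sigma(i)(x_rem) *)
}.
Arguments loc {D} _ _ _.
Arguments rem {D} _ _ _.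

Fixpoint holds {D : Type} (lt : D -> D -> Prop) (s : model D) (i : nat)
    (f : form) : Prop :=
  match f with
  | LocEqX x j y => loc s i x = loc s (i + j) y
  | LocLtX x j y => lt (loc s i x) (loc s (i + j) y)
  | RemEqX x j y => rem s i x = rem s (i + j) y
  | RemXF x y => exists j, i < j /\ rem s i x = rem s j y
  | RemXFinv x y => exists j, j < i /\ rem s i x = rem s j y
  | LocRem x y => loc s i x = rem s i y
  | FAnd p q => holds lt s i p /\ holds lt s i q
  | FNeg p => ~ holds lt s i p
  | FNext p => holds lt s (S i) p
  | FUntil p q => exists j, i <= j /\ holds lt s j q /\
                   (forall k, i <= k -> k < j -> holds lt s k p)
  | FPrev p => 1 <= i /\ holds lt s (i - 1) p
  | FSince p q => exists j, j <= i /\ holds lt s j q /\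
                   (forall k, j < k -> k <= i -> holds lt s k p)
  end.

Definition satisfiable {D : Type} (lt : D -> D -> Prop) (f : form) : Prop :=
  exists s : model D, holds lt s 0 f.

Definition strict_total_order {D : Type} (lt : D -> D -> Prop) : Prop :=
  (forall x, ~ lt x x) /\
  (forall x y z, lt x y -> lt y z -> lt x z) /\
  (forall x y, lt x y \/ x = y \/ lt y x).

Definition infinite_type (D : Type) : Prop :=
  ~ exists l : list D, forall d : D, In d l.

Inductive prf : Type :=
| PZero
| PSucc
| PProj (n : nat)
| PComp (f : prf) (gs : list prf)
| PRec (f g : prf)
| PMu (f : prf).

Inductive eval : prf -> list nat -> nat -> Prop :=
| evZero : forall xs, eval PZero xs 0
| evSucc : forall x xs, eval PSucc (x :: xs) (S x)
| evProj : forall n xs, n < length xs -> eval (PProj n) xs (nth n xs 0)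
| evComp : forall f gs xs ys y,
    Forall2 (fun g v => eval g xs v) gs ys ->
    eval f ys y -> eval (PComp f gs) xs y
| evRec0 : forall f g xs y, eval f xs y -> eval (PRec f g) (0 :: xs) y
| evRecS : forall f g n xs z y,
    eval (PRec f g) (n :: xs) z -> eval g (n :: z :: xs) y ->
    eval (PRec f g) (S n :: xs) y
| evMu : forall f xs n,
    eval f (n :: xs) 0 ->
    (forall m, m < n -> exists k, eval f (m :: xs) (S k)) ->
    eval (PMu f) xs n.

(* Goedel numbering of formulas (Cantor pairing, injective). *)
Definition cpair (a b : nat) : nat := (a + b) * (a + b + 1) / 2 + b.

Fixpoint enc (f : form) : nat :=
  match f with
  | LocEqX x i y => cpair 0 (cpair x (cpair i y))
  | LocLtX x i y => cpair 1 (cpair x (cpair i y))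
  | RemEqX x i y => cpair 2 (cpair x (cpair i y))
  | RemXF x y => cpair 3 (cpair x y)
  | RemXFinv x y => cpair 4 (cpair x y)
  | LocRem x y => cpair 5 (cpair x y)
  | FAnd p q => cpair 6 (cpair (enc p) (enc q))
  | FNeg p => cpair 7 (enc p)
  | FNext p => cpair 8 (enc p)
  | FUntil p q => cpair 9 (cpair (enc p) (enc q))
  | FPrev p => cpair 10 (enc p)
  | FSince p q => cpair 11 (cpair (enc p) (enc q))
  end.

Definition decidable_form (P : form -> Prop) : Prop :=
  exists c : prf, forall f : form,
    (P f -> eval c [enc f] 0) /\ (~ P f -> eval c [enc f] 1).

(* Main.v *)
Require Import Defs.
From Stdlib Require Import List Arith.
From Stdlib Require Import Lia Classical Sorted.
Import ListNotations.

(** Every recursive function is compiled to a counter machine, and a run of the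
    machine is described by a formula, one step per position.  A counter uses
    two non-decreasing sequences of data values, [up] and [dn]: incrementing
    moves [up] to a larger value, decrementing moves [dn] to a larger value that
    [up] took before, and the counter is zero when both agree.  The remote
    formula "[up] is met by a later [dn]" is required to be closed under going
    back in time, so [dn] visits the values of [up] in order without skipping
    any: the counter contains the number of values that [dn] has still to visit.
    Halting runs use finitely many values, so any infinite total order provides
    them.

    The input [n] is given by the conjunct "[base] equals [X^n mark]", whose code
    is computed from [n] by pairing alone.  If [c] decided satisfiability, let
    [phi] describe the machine that on input [n] runs [c] on the code of
    "the formula coded by [n], with input [n]" and accepts the answer
    "unsatisfiable"; on the input [enc phi] it refutes [c].  As [c] is total, it
    is enough that the machine simulates the evaluation relation, the converse
    is not needed. *)

(** * Counter machines for recursive functions *)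

Definition state := nat -> nat.

Definition upd (s : state) (r v : nat) : state :=
  fun x => if x =? r then v else s x.

Lemma upd_same s r v : upd s r v r = v.
Proof. unfold upd. now rewrite Nat.eqb_refl. Qed.

Lemma upd_other s r v x : x <> r -> upd s r v x = s x.
Proof. intros H. unfold upd. apply Nat.eqb_neq in H. now rewrite H. Qed.

(* [While r p] decrements [r] before each execution of [p]. *)
Inductive prog : Type :=
| Skip
| Inc (r : nat)
| Seq (p q : prog)
| While (r : nat) (p : prog).

Inductive exec : prog -> state -> state -> Prop :=
| exSkip s : exec Skip s s
| exInc r s : exec (Inc r) s (upd s r (S (s r)))
| exSeq p q s s1 s2 : exec p s s1 -> exec q s1 s2 -> exec (Seq p q) s s2
| exWhile0 r p s : s r = 0 -> exec (While r p) s s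
| exWhileS r p s s1 s2 v :
    s r = S v -> exec p (upd s r v) s1 -> exec (While r p) s1 s2 ->
    exec (While r p) s s2.

Inductive instr : Type :=
| INC (r : nat)
| DEC (r l : nat)
| JMP (l : nat).

Definition step (P : list instr) (c : nat * state) : nat * state :=
  let (q, s) := c in
  match nth_error P q with
  | Some (INC r) => (S q, upd s r (S (s r)))
  | Some (DEC r l) =>
      if s r =? 0 then (l, s) else (S q, upd s r (pred (s r)))
  | Some (JMP l) => (l, s)
  | None => (q, s)
  end.

(** Jump targets are absolute, so [o] is the address at which the code will stand. The [2] in the
    exit address counts the [DEC] and the [JMP] around the body. *)
Fixpoint flat (p : prog) (o : nat) : list instr :=
  match p with
  | Skip => []
  | Inc r => [INC r]
  | Seq p q => flat p o ++ flat q (o + length (flat p o))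
  | While r p =>
      DEC r (o + length (flat p (S o)) + 2) :: flat p (S o) ++ [JMP o]
  end.

Lemma iter_trans (P : list instr) c c1 c2 :
  (exists k, Nat.iter k (step P) c = c1) ->
  (exists k, Nat.iter k (step P) c1 = c2) ->
  exists k, Nat.iter k (step P) c = c2.
Proof.
  intros [k H] [k' H']. exists (k' + k).
  now rewrite Nat.iter_add, H.
Qed.

Lemma nth_error_mid (A B : list instr) i : nth_error (A ++ i :: B) (length A) = Some i.
Proof. rewrite nth_error_app2 by lia. now rewrite Nat.sub_diag. Qed.

(** The arbitrary code [A] and [B] on either side lets the induction hypotheses for subprograms
    speak of the same whole program [P]. A loop is unrolled once for each [exWhileS] of the
    derivation. *)
Lemma flat_exec p s s' : exec p s s' ->
  forall A B, let P := A ++ flat p (length A) ++ B in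
  exists k, Nat.iter k (step P) (length A, s)
            = (length A + length (flat p (length A)), s').
Proof.
  induction 1 as [s|r s|p q s s1 s2 _ IH1 _ IH2|r p s H0|r p s s1 s2 v Hv _ IH1 _ IH2];
    intros A B P.
  - exists 0. cbn. now rewrite Nat.add_0_r.
  - exists 1. cbn. unfold P. cbn. rewrite nth_error_mid. f_equal. lia.
  - subst P. cbn [flat]. rewrite <- app_assoc.
    specialize (IH1 A (flat q (length A + length (flat p (length A))) ++ B)).
    cbn zeta in IH1. eapply iter_trans; [exact IH1|].
    specialize (IH2 (A ++ flat p (length A)) B). cbn zeta in IH2.
    rewrite length_app, <- app_assoc in IH2.
    rewrite length_app, Nat.add_assoc. exact IH2.
  - exists 1. cbn. unfold P. cbn. rewrite nth_error_mid, H0. cbn.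
    f_equal. rewrite length_app. cbn. lia.
  - specialize (IH2 A B). cbn zeta in IH2. fold P in IH2.
    eapply iter_trans; [|exact IH2].
    apply iter_trans with (S (length A), upd s r v).
    { exists 1. cbn. unfold P. cbn. now rewrite nth_error_mid, Hv. }
    specialize (IH1 (A ++ [DEC r (length A + length (flat p (S (length A))) + 2)])
                    ([JMP (length A)] ++ B)).
    cbn zeta in IH1. rewrite length_app, Nat.add_1_r in IH1.
    match type of IH1 with context [step ?X] => replace X with P in IH1 end.
    2:{ unfold P. cbn. repeat (rewrite <- app_assoc; cbn). reflexivity. }
    eapply iter_trans; [exact IH1|].
    assert (X : nth_error P (S (length A) + length (flat p (S (length A))))
                = Some (JMP (length A))).
    { unfold P. rewrite nth_error_app2 by lia.
      replace (S _ + _ - length A) with (S (length (flat p (S (length A))))) by lia.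
      cbn. rewrite <- app_assoc. apply nth_error_mid. }
    exists 1. unfold step. cbn [Nat.iter nat_rect]. now rewrite X.
Qed.

(** * Clearing and copying registers *)

Definition clear (r : nat) : prog := While r Skip.

(** A loop consumes its counter, so [x] is emptied into both [y] and [t] and then restored from
    [t]. *)
Definition copy (x y t : nat) : prog :=
  Seq (clear y) (Seq (clear t)
    (Seq (While x (Seq (Inc y) (Inc t))) (While t (Inc x)))).

Lemma exec_clear r s :
  exists s', exec (clear r) s s' /\ s' r = 0 /\ forall x, x <> r -> s' x = s x.
Proof.
  remember (s r) as v eqn:Hv. revert s Hv.
  induction v as [|v IH]; intros s Hv.
  - exists s. split; [now constructor|auto].
  - destruct (IH (upd s r v)) as (s' & E & E0 & E1); [now rewrite upd_same|].
    exists s'. split; [|split; [exact E0|]].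
    + eapply exWhileS; [now symmetry in Hv; apply Hv|constructor|exact E].
    + intros x Hx. rewrite E1 by assumption. now apply upd_other.
Qed.

Lemma exec_copy x y t s : x <> y -> x <> t -> y <> t ->
  exists s', exec (copy x y t) s s' /\ s' y = s x /\
    forall r, r <> y -> r <> t -> s' r = s r.
Proof.
  intros Hxy Hxt Hyt.
  destruct (exec_clear y s) as (s1 & E1 & Z1 & F1).
  destruct (exec_clear t s1) as (s2 & E2 & Z2 & F2).
  assert (L1 : forall v s, s x = v -> exists s',
    exec (While x (Seq (Inc y) (Inc t))) s s' /\ s' x = 0 /\ s' y = s y + v /\
    s' t = s t + v /\ forall r, r <> x -> r <> y -> r <> t -> s' r = s r).
  { clear -Hxy Hxt Hyt. induction v as [|v IH]; intros s Hv.
    - exists s. split; [now constructor|]. repeat split; auto; lia.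
    - set (sa := upd s x v). set (sb := upd sa y (S (sa y))).
      set (sc := upd sb t (S (sb t))).
      assert (Hc : sc x = v /\ sc y = S (s y) /\ sc t = S (s t) /\
        forall r, r <> x -> r <> y -> r <> t -> sc r = s r).
      { unfold sc, sb, sa. repeat split; intros;
          repeat first [rewrite upd_same | rewrite upd_other by auto]; reflexivity. }
      destruct Hc as (C1 & C2 & C3 & C4).
      destruct (IH sc C1) as (s' & E & X1 & X2 & X3 & X4).
      exists s'. split; [|repeat split; try lia].
      + eapply exWhileS; [exact Hv| |exact E].
        eapply exSeq; constructor.
      + intros. rewrite X4 by auto. auto. }
  assert (L2 : forall v s, s t = v -> exists s',
    exec (While t (Inc x)) s s' /\ s' x = s x + v /\
    forall r, r <> x -> r <> t -> s' r = s r).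
  { clear -Hxy Hxt Hyt. induction v as [|v IH]; intros s Hv.
    - exists s. split; [now constructor|]. repeat split; auto; lia.
    - set (sa := upd s t v). set (sc := upd sa x (S (sa x))).
      assert (Hc : sc t = v /\ sc x = S (s x) /\
        forall r, r <> x -> r <> t -> sc r = s r).
      { unfold sc, sa. repeat split; intros;
          repeat first [rewrite upd_same | rewrite upd_other by auto]; reflexivity. }
      destruct Hc as (C1 & C2 & C4).
      destruct (IH sc C1) as (s' & E & X1 & X4).
      exists s'. split; [|repeat split; try lia].
      + eapply exWhileS; [exact Hv| |exact E]. constructor.
      + intros. rewrite X4 by auto. auto. }
  destruct (L1 _ s2 eq_refl) as (s3 & E3 & A1 & A2 & A3 & A4).
  destruct (L2 _ s3 eq_refl) as (s4 & E4 & B1 & B2).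
  exists s4. split.
  { eapply exSeq; [exact E1|]. eapply exSeq; [exact E2|].
    eapply exSeq; [exact E3|exact E4]. }
  assert (F : s2 x = s x) by (rewrite F2, F1; auto).
  assert (Gy : s2 y = 0) by (rewrite F2; auto).
  split.
  - rewrite B2 by auto. lia.
  - intros r Hy Ht. destruct (Nat.eq_dec r x) as [->|Hx]; [lia|].
    rewrite B2, A4, F2, F1; auto.
Qed.

(* Arguments are read from the registers [args], all below [o]; the result goes
   to [o], and every register above [o] is scratch. *)
Fixpoint comp (f : prf) (args : list nat) (o : nat) {struct f} : prog :=
  match f with
  | PZero => clear o
  | PSucc =>
      match args with
      | x :: _ => Seq (copy x o (S o)) (Inc o)
      | [] => Skip
      end
  | PProj n => copy (nth n args 0) o (S o)
  | PComp f gs =>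
      Seq ((fix comps (gs : list prf) (o' : nat) : prog :=
              match gs with
              | [] => Skip
              | g :: gs => Seq (comp g args o') (comps gs (S o'))
              end) gs (S o))
        (Seq (comp f (seq (S o) (length gs)) (S o + length gs))
             (copy (S o + length gs) o (2 + o + length gs)))
  | PRec f g =>
      match args with
      | x :: args' =>
          Seq (copy x o (S o)) (Seq (clear (1 + o))
            (Seq (comp f args' (2 + o))
              (Seq (While o (Seq (comp g (1 + o :: 2 + o :: args') (3 + o))
                       (Seq (copy (3 + o) (2 + o) (4 + o)) (Inc (1 + o)))))
                 (copy (2 + o) o (1 + o)))))
      | [] => Skip
      end
  | PMu f =>
      Seq (clear o) (Seq (comp f (o :: args) (1 + o))
        (While (1 + o) (Seq (Inc o) (comp f (o :: args) (1 + o)))))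
  end.

(** Subroutines are called with shifted targets and with other argument registers, hence the
    quantification over [args], [o] and [s]. Preservation below [o] protects the arguments and the
    results already obtained by a caller. *)
Definition computes (f : prf) : Prop :=
  forall args o s v, Forall (fun r => r < o) args -> eval f (map s args) v ->
  exists s', exec (comp f args o) s s' /\ s' o = v /\ forall r, r < o -> s' r = s r.

Fixpoint prf_ind' (Q : prf -> Prop) (H0 : Q PZero) (H1 : Q PSucc)
  (H2 : forall n, Q (PProj n))
  (H3 : forall f gs, Q f -> Forall Q gs -> Q (PComp f gs))
  (H4 : forall f g, Q f -> Q g -> Q (PRec f g))
  (H5 : forall f, Q f -> Q (PMu f)) (f : prf) : Q f :=
  let rc := prf_ind' Q H0 H1 H2 H3 H4 H5 in
  match f with
  | PZero => H0
  | PSucc => H1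
  | PProj n => H2 n
  | PComp f gs => H3 f gs (rc f)
      ((fix go (gs : list prf) : Forall Q gs :=
          match gs with
          | [] => Forall_nil Q
          | g :: gs => Forall_cons g (rc g) (go gs)
          end) gs)
  | PRec f g => H4 f g (rc f) (rc g)
  | PMu f => H5 f (rc f)
  end.

Lemma map_agree (s s' : state) l o :
  Forall (fun r => r < o) l -> (forall r, r < o -> s' r = s r) -> map s' l = map s l.
Proof.
  intros Hl H. apply map_ext_in. intros a Ha.
  rewrite Forall_forall in Hl. auto.
Qed.

Lemma Forall_lt_le l o o' :
  Forall (fun r => r < o) l -> o <= o' -> Forall (fun r => r < o') l.
Proof. intros H Ho. eapply Forall_impl; [|exact H]. cbn. lia. Qed.

(** Primitive recursion unrolled in the order in which a loop performs it: index [i], accumulator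
    [z], and [m] rounds left before the value [v]. *)
Fixpoint chain (g : prf) (ys : list nat) (i m z v : nat) : Prop :=
  match m with
  | 0 => z = v
  | S m => exists z1, eval g (i :: z :: ys) z1 /\ chain g ys (S i) m z1 v
  end.

(** [evRecS] exposes the last round while [chain] exposes the first; appending at the far end
    reconciles the two. *)
Lemma chain_snoc g ys m : forall i z v w,
  chain g ys i m z v -> eval g (i + m :: v :: ys) w -> chain g ys i (S m) z w.
Proof.
  induction m as [|m IH]; intros i z v w H E.
  - cbn in H. subst. rewrite Nat.add_0_r in E. exists w. now split.
  - destruct H as (z1 & E1 & H). exists z1. split; [exact E1|].
    apply IH with v; [exact H|]. now replace (S i + m) with (i + S m) by lia.
Qed.

Lemma eval_PRec_chain f g ys n v :
  eval (PRec f g) (n :: ys) v -> exists z, eval f ys z /\ chain g ys 0 n z v.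
Proof.
  revert v. induction n as [|n IH]; intros v H; inversion H; subst.
  - exists v. now split.
  - match goal with H : eval (PRec f g) _ _ |- _ => apply IH in H as (z0 & E & C) end.
    exists z0. split; [exact E|]. eapply chain_snoc; eauto.
Qed.

Lemma comp_correct f : computes f.
Proof.
  induction f as [| |n|f gs IHf IHgs|f g IHf IHg|f IHf] using prf_ind';
    intros args o s v Ha He.
  - inversion He; subst. destruct (exec_clear o s) as (s' & E & E0 & E1).
    exists s'. repeat split; auto. intros r Hr. apply E1. lia.
  - destruct args as [|x args]; cbn in He; inversion He; subst. inversion Ha; subst.
    destruct (exec_copy x o (S o) s) as (s' & E & E0 & E1); try lia.
    exists (upd s' o (S (s' o))). repeat split.
    + cbn. eapply exSeq; [exact E|constructor].
    + now rewrite upd_same, E0.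
    + intros r Hr. rewrite upd_other by lia. apply E1; lia.
  - inversion He; subst. rewrite length_map in *.
    assert (Hx : nth n args 0 < o).
    { rewrite Forall_forall in Ha. apply Ha. now apply nth_In. }
    destruct (exec_copy (nth n args 0) o (S o) s) as (s' & E & E0 & E1); try lia.
    exists s'. split; [exact E|]. split.
    + rewrite E0, <- (map_nth s args 0 n). apply nth_indep. now rewrite length_map.
    + intros r Hr. apply E1; lia.
  - inversion He as [| | |f' gs' xs ys y HF HE| | |]; subst.
    cbn [comp].
    match goal with |- context [Seq (?F gs (S o)) _] => set (comps := F) end.
    (* The arguments go to consecutive registers; each call preserves everything below its own
       target, so the earlier results survive. *)
    assert (L : forall gs, Forall computes gs -> forall ys o' s0, o <= o' ->
      (forall r, r < o -> s0 r = s r) ->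
      Forall2 (fun g v => eval g (map s args) v) gs ys ->
      exists s', exec (comps gs o') s0 s' /\ (forall r, r < o' -> s' r = s0 r) /\
        map s' (seq o' (length gs)) = ys).
    { clear -Ha. induction 1 as [|g gs Hg _ IH]; intros ys o' s0 Ho H0 HF.
      - inversion HF; subst. exists s0. repeat split; auto. constructor.
      - inversion HF as [|? w ? ys' Hgv HF']; subst.
        destruct (Hg args o' s0 w) as (s1 & E1 & V1 & K1).
        { eapply Forall_lt_le; eauto. }
        { rewrite (map_agree s s0 args o); auto. }
        destruct (IH ys' (S o') s1) as (s2 & E2 & K2 & M2); auto.
        { intros r Hr. rewrite K1, H0; auto; lia. }
        exists s2. repeat split.
        + cbn. eapply exSeq; eauto.
        + intros r Hr. rewrite K2, K1; auto; lia.
        + cbn. rewrite K2, V1, M2 by lia. reflexivity. }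
    destruct (L gs IHgs ys (S o) s) as (s1 & E1 & K1 & M1); auto.
    destruct (IHf (seq (S o) (length gs)) (S o + length gs) s1 v)
      as (s2 & E2 & V2 & K2).
    { apply Forall_forall. intros r Hr. apply in_seq in Hr. lia. }
    { now rewrite M1. }
    destruct (exec_copy (S o + length gs) o (2 + o + length gs) s2)
      as (s3 & E3 & V3 & K3); try lia.
    exists s3. repeat split.
    + eapply exSeq; [exact E1|]. eapply exSeq; eauto.
    + now rewrite V3.
    + intros r Hr. rewrite K3, K2, K1; lia.
  - destruct args as [|x args]; [inversion He|].
    inversion Ha as [|? ? Hx Ha']; subst. cbn [comp].
    destruct (exec_copy x o (S o) s) as (s1 & E1 & V1 & K1); try lia.
    destruct (exec_clear (1 + o) s1) as (s2 & E2 & V2 & K2).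
    assert (A2 : forall r, r < o -> s2 r = s r).
    { intros r Hr. rewrite K2, K1; lia. }
    cbn [map] in He. apply eval_PRec_chain in He as (z & Hz & HC).
    destruct (IHf args (2 + o) s2 z) as (s3 & E3 & V3 & K3).
    { eapply Forall_lt_le; eauto. lia. }
    { rewrite (map_agree s s2 args o); auto. }
    (* Loop invariant: [o] counts the rounds left, [1 + o] contains the index and [2 + o] the
       accumulator. *)
    assert (L : forall m i z s0, s0 o = m -> s0 (1 + o) = i -> s0 (2 + o) = z ->
      (forall r, r < o -> s0 r = s r) -> chain g (map s args) i m z v ->
      exists s', exec (While o (Seq (comp g (1 + o :: 2 + o :: args) (3 + o))
                       (Seq (copy (3 + o) (2 + o) (4 + o)) (Inc (1 + o))))) s0 s' /\
        s' (2 + o) = v /\ forall r, r < o -> s' r = s r).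
    { clear -Ha' IHg. induction m as [|m IH]; intros i z s0 Hm Hi Hz K C.
      - cbn in C. subst z. exists s0. split; [now constructor|auto].
      - destruct C as (z1 & G & C).
        destruct (IHg (1 + o :: 2 + o :: args) (3 + o) (upd s0 o m) z1)
          as (t1 & E1 & V1 & K1).
        { repeat constructor; try lia. eapply Forall_lt_le; eauto. lia. }
        { cbn [map]. rewrite !upd_other by lia. rewrite Hi, Hz.
          rewrite (map_agree s (upd s0 o m) args o); auto.
          intros r Hr. rewrite upd_other by lia. auto. }
        destruct (exec_copy (3 + o) (2 + o) (4 + o) t1) as (t2 & E2 & V2 & K2); try lia.
        destruct (IH (S i) z1 (upd t2 (1 + o) (S (t2 (1 + o))))) as (t3 & E3 & V3 & K3).
        { rewrite upd_other, K2, K1, upd_same by lia. reflexivity. }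
        { rewrite upd_same, K2, K1, upd_other by lia. now rewrite Hi. }
        { rewrite upd_other by lia. congruence. }
        { intros r Hr. rewrite upd_other, K2, K1, upd_other by lia. auto. }
        { exact C. }
        exists t3. split; [|auto].
        eapply exWhileS; [exact Hm| |exact E3].
        eapply exSeq; [exact E1|]. eapply exSeq; [exact E2|]. constructor. }
    destruct (L (s x) 0 z s3) as (s4 & E4 & V4 & K4); auto.
    { rewrite K3, K2; lia. }
    { rewrite K3; lia. }
    { intros r Hr. rewrite K3 by lia. auto. }
    destruct (exec_copy (2 + o) o (1 + o) s4) as (s5 & E5 & V5 & K5); try lia.
    exists s5. repeat split.
    + repeat (eapply exSeq; [eassumption|]). exact E5.
    + congruence.
    + intros r Hr. rewrite K5 by lia. auto.
  - inversion He as [| | | | | |f' xs n Hn Hlt]; subst. cbn [comp].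
    destruct (exec_clear o s) as (s1 & E1 & V1 & K1).
    assert (B : forall i s0 w, s0 o = i -> (forall r, r < o -> s0 r = s r) ->
      eval f (i :: map s args) w ->
      exists s', exec (comp f (o :: args) (1 + o)) s0 s' /\ s' o = i /\
        s' (1 + o) = w /\ forall r, r < o -> s' r = s r).
    { intros i s0 w Hi K E.
      destruct (IHf (o :: args) (1 + o) s0 w) as (s' & E' & V' & K').
      - constructor; [lia|]. eapply Forall_lt_le; eauto.
      - cbn [map]. rewrite Hi, (map_agree s s0 args o); auto.
      - exists s'. repeat split; auto. + rewrite K'; auto.
        + intros r Hr. rewrite K' by lia. auto. }
    (* Here [m] is the distance from the candidate [i] to the minimum [v], and the test value [w] is
       zero exactly when [m] is. The loop spoils [1 + o] by decrementing it, but its body recomputes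
       that register. *)
    assert (L : forall m i w s0, i + m = v -> s0 o = i -> s0 (1 + o) = w ->
      eval f (i :: map s args) w -> (m = 0 -> w = 0) -> (m <> 0 -> w <> 0) ->
      (forall r, r < o -> s0 r = s r) ->
      exists s', exec (While (1 + o) (Seq (Inc o) (comp f (o :: args) (1 + o)))) s0 s'
        /\ s' o = v /\ forall r, r < o -> s' r = s r).
    { clear IHf E1. induction m as [|m IH]; intros i w s0 Hi Ho Hw E W0 W1 K.
      - exists s0. split; [constructor; rewrite Hw; auto|]. split; [lia|auto].
      - assert (exists w', eval f (S i :: map s args) w' /\ (m = 0 -> w' = 0)
                  /\ (m <> 0 -> w' <> 0)) as (w' & E' & W0' & W1').
        { destruct m as [|m].
          - exists 0. replace (S i) with v by lia. auto.
          - destruct (Hlt (S i)) as (k & Hk); [lia|].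
            exists (S k). split; [exact Hk|]. split; lia. }
        destruct w as [|w]; [now destruct W1|].
        destruct (B (S i) (upd (upd s0 (1 + o) w) o (S (upd s0 (1 + o) w o))) w')
          as (t1 & X1 & Y1 & Z1 & T1); auto.
        { rewrite upd_same, upd_other by lia. now rewrite Ho. }
        { intros r Hr. rewrite !upd_other by lia. auto. }
        destruct (IH (S i) w' t1) as (t2 & X2 & Y2 & Z2); auto; [lia|].
        exists t2. split; [|auto].
        eapply exWhileS; [exact Hw| |exact X2].
        eapply exSeq; [constructor|exact X1]. }
    assert (exists w, eval f (0 :: map s args) w /\ (v = 0 -> w = 0)
              /\ (v <> 0 -> w <> 0)) as (w & E & W0 & W1).
    { destruct v as [|v].
      - exists 0. auto.
      - destruct (Hlt 0) as (k & Hk); [lia|].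
        exists (S k). split; [exact Hk|]. split; lia. }
    destruct (B 0 s1 w) as (s2 & E2 & Y2 & Z2 & K2); auto.
    { intros r Hr. apply K1. lia. }
    destruct (L v 0 w s2) as (s3 & E3 & Y3 & K3); auto.
    exists s3. split; [|auto].
    eapply exSeq; [exact E1|]. eapply exSeq; [exact E2|exact E3].
Qed.

(** * The formula of a machine *)

Definition FTrue : form := LocEqX 0 0 0.
Definition FImp (p q : form) : form := FNeg (FAnd p (FNeg q)).
Definition FOr (p q : form) : form := FNeg (FAnd (FNeg p) (FNeg q)).
Definition FAll (l : list form) : form := fold_right FAnd FTrue l.
Definition FAlways (p : form) : form := FNeg (FUntil FTrue (FNeg p)).

Section Semantics.
Context {D : Type} (lt : D -> D -> Prop) (s : model D).

Lemma holds_FTrue i : holds lt s i FTrue.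
Proof. cbn. now rewrite Nat.add_0_r. Qed.

Lemma holds_FImp i p q :
  holds lt s i (FImp p q) <-> (holds lt s i p -> holds lt s i q).
Proof. cbn. destruct (classic (holds lt s i q)); tauto. Qed.

Lemma holds_FOr i p q :
  holds lt s i (FOr p q) <-> holds lt s i p \/ holds lt s i q.
Proof. cbn. destruct (classic (holds lt s i q)); tauto. Qed.

Lemma holds_FAll {A : Type} i (f : A -> form) l :
  holds lt s i (FAll (map f l)) <-> forall a, In a l -> holds lt s i (f a).
Proof.
  induction l as [|a l IH].
  - split; [intros _ b []|intros _; apply holds_FTrue].
  - cbn. fold (FAll (map f l)). rewrite IH. split.
    + intros [H1 H2] b [<-|Hb]; auto.
    + intros H. split; auto.
Qed.

Lemma holds_FAlways i p :
  holds lt s i (FAlways p) <-> forall j, i <= j -> holds lt s j p.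
Proof.
  unfold FAlways. split.
  - intros H j Hj. apply NNPP. intros N. apply H. exists j.
    repeat split; [exact Hj|exact N|]. intros. apply holds_FTrue.
  - intros H (j & Hj & N & _). exact (N (H j Hj)).
Qed.
End Semantics.

Lemma holds_FAnd {D : Type} (lt : D -> D -> Prop) s i p q :
  holds lt s i (FAnd p q) <-> holds lt s i p /\ holds lt s i q.
Proof. reflexivity. Qed.

Lemma holds_FNext {D : Type} (lt : D -> D -> Prop) s i p :
  holds lt s i (FNext p) <-> holds lt s (S i) p.
Proof. reflexivity. Qed.

(* Variables.  [up r] moves to a larger value when register [r] is incremented,
   [dn r] when it is decremented, and the remote variables [up r], [dn r] copy
   the local ones.  Register [r] is zero when [up r] and [dn r] agree; label [q]
   is active when [lab q] equals the constant [base]. *)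
Definition up (r : nat) : nat := 4 * r.
Definition dn (r : nat) : nat := 4 * r + 1.
Definition lab (q : nat) : nat := 4 * q + 2.
Definition base : nat := 3.
Definition mark : nat := 7.

Arguments up : simpl never.
Arguments dn : simpl never.
Arguments lab : simpl never.
Arguments base : simpl never.
Arguments mark : simpl never.

Inductive change : Type := Keep | Up | Down.

Definition changes (k : change) (v w : nat) : Prop :=
  match k with
  | Keep => w = v
  | Up => w = S v
  | Down => v = S w
  end.

(** For [Down], the past operator confines the new value of [dn r] to earlier values of [up r]. This
    alone permits jumps over several of them, which [reg_form] excludes. *)
Definition chg (k : change) (r : nat) : form :=
  match k with
  | Keep => FAnd (LocEqX (up r) 1 (up r)) (LocEqX (dn r) 1 (dn r))
  | Up => FAnd (LocLtX (up r) 1 (up r)) (LocEqX (dn r) 1 (dn r))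
  | Down => FAnd (LocEqX (up r) 1 (up r))
              (FAnd (LocLtX (dn r) 1 (dn r)) (FNext (RemXFinv (dn r) (up r))))
  end.

Definition only (k : change) (r : nat) : nat -> change :=
  fun r' => if r' =? r then k else Keep.

Definition goto (rs : list nat) (l : nat) (op : nat -> change) : form :=
  FAnd (FNext (LocEqX base 0 (lab l))) (FAll (map (fun r => chg (op r) r) rs)).

Definition zero (r : nat) : form := LocEqX (up r) 0 (dn r).

Definition instr_form (rs : list nat) (q : nat) (c : instr) : form :=
  match c with
  | INC r => goto rs (S q) (only Up r)
  | DEC r l =>
      FAnd (FImp (zero r) (goto rs l (fun _ => Keep)))
           (FImp (FNeg (zero r)) (goto rs (S q) (only Down r)))
  | JMP l => goto rs l (fun _ => Keep)
  end.

Definition matched (r : nat) : form := RemXF (up r) (dn r).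

(** Order is available on local variables only and [XF] on remote ones only; the first two conjuncts
    let both speak of the same values. Then come monotonicity of [dn r] and the backward closure of
    [matched r]. *)
Definition reg_form (r : nat) : form :=
  FAnd (FAnd (LocRem (up r) (up r)) (LocRem (dn r) (dn r)))
    (FAnd (FOr (LocEqX (dn r) 1 (dn r)) (LocLtX (dn r) 1 (dn r)))
       (FImp (FNext (matched r)) (matched r))).

Definition prog_form (rs : list nat) (P : list instr) : form :=
  FAll (map (fun qc => FImp (LocEqX base 0 (lab (fst qc)))
                            (instr_form rs (fst qc) (snd qc)))
         (combine (seq 0 (length P)) P)).

(** Compiled code halts at the first label past its end. Output zero would be the answer that the
    formula is satisfiable. *)
Definition halt_form (P : list instr) (out : nat) : form :=
  FImp (LocEqX base 0 (lab (length P))) (FNeg (zero out)).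

Definition marked : form := LocEqX base 0 mark.

(** The default [0] for [JMP] adds nothing new, since [run_form] lists register 0 in any case. *)
Definition regs (P : list instr) : list nat :=
  map (fun c => match c with INC r | DEC r _ => r | JMP _ => 0 end) P.

(* Register 0 is incremented until the marked position, where [P] starts. *)
Definition run_form (P : list instr) (out : nat) : form :=
  let rs := 0 :: out :: regs P in
  FAnd (FAll (map zero rs))
  (FAnd (FAlways (FAnd (LocEqX base 1 base) (FAll (map reg_form rs))))
    (FUntil
      (FAnd (FNeg marked) (FAll (map (fun r => chg (only Up 0 r) r) rs)))
      (FAnd marked (FAnd (FNext (FAlways (FNeg marked)))
         (FAnd (LocEqX base 0 (lab 0))
           (FAlways (FAnd (prog_form rs P) (halt_form P out)))))))).

(** Evaluated at position 0; as [base] is constant, it says that [marked] holds at position [n]. *)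
Definition input_form (n : nat) : form := LocEqX base n mark.

Lemma In_combine_seq {A : Type} (l : list A) a q c :
  In (q, c) (combine (seq a (length l)) l) <-> (a <= q /\ nth_error l (q - a) = Some c).
Proof.
  revert a. induction l as [|b l IH]; intros a; cbn.
  - split; [intros []|]. intros [_ H]. destruct (q - a); discriminate.
  - rewrite IH. split.
    + intros [H|[H1 H2]].
      * injection H as <- <-. rewrite Nat.sub_diag. auto.
      * split; [lia|]. replace (q - a) with (S (q - S a)) by lia. exact H2.
    + intros [H1 H2]. destruct (Nat.eq_dec q a) as [->|Hne].
      * rewrite Nat.sub_diag in H2. injection H2 as <-. now left.
      * right. split; [lia|].
        replace (q - a) with (S (q - S a)) in H2 by lia. exact H2.
Qed.

Lemma holds_prog_form {D : Type} (lt : D -> D -> Prop) s i rs P :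
  holds lt s i (prog_form rs P) <->
  forall q c, nth_error P q = Some c -> holds lt s i (LocEqX base 0 (lab q)) ->
    holds lt s i (instr_form rs q c).
Proof.
  unfold prog_form. rewrite holds_FAll. split.
  - intros H q c Hc Hq.
    specialize (H (q, c)). rewrite holds_FImp in H. apply H; [|exact Hq].
    apply In_combine_seq. rewrite Nat.sub_0_r. split; [lia|exact Hc].
  - intros H [q c] Hin. apply In_combine_seq in Hin as [_ Hin].
    rewrite Nat.sub_0_r in Hin. rewrite holds_FImp. apply H. exact Hin.
Qed.

Lemma holds_goto {D : Type} (lt : D -> D -> Prop) s i rs l op :
  holds lt s i (goto rs l op) <->
  holds lt s (S i) (LocEqX base 0 (lab l)) /\
  forall r, In r rs -> holds lt s i (chg (op r) r).
Proof.
  unfold goto. now rewrite holds_FAnd, holds_FNext, holds_FAll.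
Qed.

(** * Total increments and decrements of a counter *)

Fixpoint incs (R : nat -> nat) (i : nat) : nat :=
  match i with
  | 0 => 0
  | S i => incs R i + (R (S i) - R i)
  end.

Fixpoint decs (R : nat -> nat) (i : nat) : nat :=
  match i with
  | 0 => 0
  | S i => decs R i + (R i - R (S i))
  end.

Lemma incs_decs R i : R 0 = 0 -> incs R i = decs R i + R i.
Proof. intros H. induction i as [|i IH]; cbn; lia. Qed.

(** A discrete intermediate value theorem. *)
Lemma small_steps (f : nat -> nat) a b m :
  a <= b -> (forall i, a <= i < b -> f (S i) <= S (f i)) -> f a <= m <= f b ->
  exists j, a <= j <= b /\ f j = m.
Proof.
  intros Hab. revert m. induction Hab as [|b Hab IH]; intros m Hs Hm.
  - exists a. lia.
  - destruct (Nat.eq_dec m (f (S b))) as [->|Hne].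
    + exists (S b). lia.
    + destruct (IH m) as (j & Hj & E).
      * intros i Hi. apply Hs. lia.
      * specialize (Hs b). lia.
      * exists j. split; [lia|exact E].
Qed.

Lemma incs_mono R a b : a <= b -> incs R a <= incs R b.
Proof. induction 1; cbn; lia. Qed.

Lemma decs_mono R a b : a <= b -> decs R a <= decs R b.
Proof. induction 1; cbn; lia. Qed.

Section Soundness.
Context {D : Type} (lt : D -> D -> Prop) (Hlt : strict_total_order lt).
Context (s : model D).

(** Up to position [i], [incs R j] acts as the rank of the value of [up r] at [j], and [dn r] at [j]
    takes the value of rank [decs R j]. *)
Definition faithful (R : nat -> nat) (r i : nat) : Prop :=
  (forall j k, j <= i -> k <= i -> incs R j = incs R k ->
     loc s j (up r) = loc s k (up r)) /\
  (forall j k, j <= i -> k <= i -> incs R j < incs R k ->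
     lt (loc s j (up r)) (loc s k (up r))) /\
  (forall j k, j <= i -> k <= i -> decs R j = incs R k ->
     loc s j (dn r) = loc s k (up r)).

(** By [incs_decs], the ranks of [up r] and [dn r] at [i] differ by exactly [R i], and distinct
    ranks have distinct values. *)
Lemma faithful_zero R r i : R 0 = 0 -> (forall j, R (S j) <= S (R j)) ->
  faithful R r i -> (holds lt s i (zero r) <-> R i = 0).
Proof.
  intros R0 RS (A & B & C). cbn. rewrite Nat.add_0_r.
  pose proof (incs_decs R i R0) as E.
  destruct (small_steps (incs R) 0 i (decs R i)) as (k & Hk & Ek); [lia| |cbn; lia|].
  { intros j _. cbn. specialize (RS j). lia. }
  rewrite (C i k) by lia. split.
  - intros H. destruct (Nat.eq_dec (R i) 0) as [|Hne]; [assumption|].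
    assert (L : lt (loc s k (up r)) (loc s i (up r))) by (apply B; lia).
    rewrite H in L. now apply Hlt in L.
  - intros H. apply A; lia.
Qed.

Context (r : nat) (Hreg : forall i, holds lt s i (reg_form r)).

Lemma reg_up i : rem s i (up r) = loc s i (up r).
Proof. destruct (Hreg i) as [[H _] _]. now symmetry. Qed.

Lemma reg_dn i : rem s i (dn r) = loc s i (dn r).
Proof. destruct (Hreg i) as [[_ H] _]. now symmetry. Qed.

Lemma dn_mono i j : i <= j -> ~ lt (loc s j (dn r)) (loc s i (dn r)).
Proof.
  destruct Hlt as (I & T & _).
  induction 1 as [|j _ IH]; [apply I|]. intros H.
  destruct (Hreg j) as [_ [M _]]. rewrite holds_FOr in M. cbn in M.
  rewrite Nat.add_1_r in M. destruct M as [M|M].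
  - rewrite <- M in H. auto.
  - apply IH. eapply T; eauto.
Qed.

Lemma matched_back i j : i <= j -> holds lt s j (matched r) -> holds lt s i (matched r).
Proof.
  induction 1 as [|j _ IH]; [auto|]. intros H. apply IH.
  destruct (Hreg j) as [_ [_ M]]. rewrite holds_FImp in M. now apply M.
Qed.

(** The critical case is [Down]: the new value of [dn r] is a value of [up r] of rank above
    [decs R i], and backward closure of [matched r] forces this rank to be the very next one. *)
Lemma faithful_step R k i : R 0 = 0 -> (forall j, R (S j) <= S (R j)) ->
  faithful R r i -> changes k (R i) (R (S i)) -> holds lt s i (chg k r) ->
  faithful R r (S i).
Proof.
  intros R0 RS F Hk Hc. pose proof F as (A & B & C).
  destruct Hlt as (Irr & Tr & Tot).
  pose proof (incs_decs R i R0) as E.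
  (* Since the counter grows by at most one at a time, every rank is attained by [up r]. *)
  assert (G : forall m, m <= incs R i -> exists j, j <= i /\ incs R j = m).
  { intros m Hm. destruct (small_steps (incs R) 0 i m) as (j & Hj & Ej);
      [lia| |cbn; lia|exists j; split; [lia|auto]].
    intros j _. cbn. specialize (RS j). lia. }
  (* Shared by [Keep] and [Down]: [up r] does not move, so it is enough to locate the new value of
     [dn r] at the right rank. *)
  assert (Hd : decs R (S i) <= incs R i ->
    forall j, j <= i -> incs R j = decs R (S i) ->
      loc s (S i) (dn r) = loc s j (up r) ->
    k <> Up -> faithful R r (S i)).
  { intros _ j Hj Ej Ed Hn.
    assert (Eu : loc s (S i) (up r) = loc s i (up r)).
    { destruct k; [|now destruct Hn|]; destruct Hc as [Hc _]; cbn in Hc;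
        rewrite Nat.add_1_r in Hc; now symmetry. }
    assert (Ei : incs R (S i) = incs R i).
    { cbn. destruct k; cbn in Hk; [lia|now destruct Hn|lia]. }
    assert (X : forall a, a <= S i -> exists a', a' <= i /\ incs R a = incs R a' /\
       loc s a (up r) = loc s a' (up r)).
    { intros a Ha. destruct (Nat.eq_dec a (S i)) as [->|]; [exists i|exists a];
        repeat split; auto; lia. }
    repeat split.
    - intros a b Ha Hb. destruct (X a Ha) as (a' & ? & -> & ->).
      destruct (X b Hb) as (b' & ? & -> & ->). auto.
    - intros a b Ha Hb. destruct (X a Ha) as (a' & ? & -> & ->).
      destruct (X b Hb) as (b' & ? & -> & ->). auto.
    - intros a b Ha Hb. destruct (X b Hb) as (b' & ? & -> & ->).
      destruct (Nat.eq_dec a (S i)) as [->|]; [|apply C; lia].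
      intros Eab. rewrite Ed. apply A; auto. lia. }
  destruct k; cbn in Hk.
  - destruct (G (decs R i)) as (j & Hj & Ej); [lia|].
    assert (E' : decs R (S i) = decs R i) by (cbn; lia).
    apply Hd with j; try lia; [|discriminate].
    destruct Hc as [_ Hc]. cbn in Hc. rewrite Nat.add_1_r in Hc.
    rewrite <- Hc. apply C; lia.
  - destruct Hc as [Hu Hdn]. cbn in Hu, Hdn. rewrite Nat.add_1_r in Hu, Hdn.
    assert (Ei : incs R (S i) = S (incs R i)) by (cbn; lia).
    assert (Di : decs R (S i) = decs R i) by (cbn; lia).
    assert (M : forall a, a <= i -> incs R a <= incs R i)
      by (intros; now apply incs_mono).
    assert (N : forall a, a <= i -> decs R a <= decs R i)
      by (intros; now apply decs_mono).
    assert (L : forall a, a <= i -> lt (loc s a (up r)) (loc s (S i) (up r))).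
    { intros a Ha. destruct (Nat.eq_dec (incs R a) (incs R i)) as [Ea|Ea].
      - rewrite (A a i); auto.
      - apply Tr with (loc s i (up r)); [apply B; auto|exact Hu].
        specialize (M a Ha). lia. }
    repeat split; intros a b Ha Hb;
      destruct (Nat.eq_dec a (S i)) as [->|Ha'];
      destruct (Nat.eq_dec b (S i)) as [->|Hb']; intros Hab; try reflexivity;
      try (pose proof (M a)); try (pose proof (M b)); try (pose proof (N a));
      try lia.
    + apply A; lia.
    + apply L; lia.
    + apply B; lia.
    + rewrite <- Hdn. apply C; lia.
    + apply C; lia.
  - destruct Hc as [_ [Hdn (j & Hj & Hjr)]]. cbn in Hdn. rewrite Nat.add_1_r in Hdn.
    rewrite reg_dn, reg_up in Hjr.
    assert (Di : decs R (S i) = S (decs R i)) by (cbn; lia).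
    assert (Dj : decs R i < incs R j).
    { destruct (G (decs R i)) as (k & Hk' & Ek); [lia|].
      rewrite (C i k), Hjr in Hdn by lia.
      destruct (lt_eq_lt_dec (decs R i) (incs R j)) as [[|Eq]|Lt]; auto; exfalso.
      - apply (Irr (loc s k (up r))). rewrite (A j k) in Hdn by lia. exact Hdn.
      - apply (Irr (loc s k (up r))). eapply Tr; [exact Hdn|apply B; lia]. }
    destruct (Nat.eq_dec (incs R j) (S (decs R i))) as [Ej|Ej].
    { apply Hd with j; auto; [lia|lia|lia|discriminate]. }
    exfalso.
    (* The value after [dn r] was skipped, so no later [dn r] can match it. *)
    destruct (G (S (decs R i))) as (j0 & Hj0 & Ej0); [lia|].
    assert (Hjj : j0 <= j).
    { destruct (le_gt_dec j0 j) as [|Hgt]; auto.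
      pose proof (incs_mono R j j0). lia. }
    assert (Mj : holds lt s j (matched r)).
    { exists (S i). split; [lia|]. rewrite reg_dn, reg_up. now symmetry. }
    apply (matched_back j0 j Hjj) in Mj. destruct Mj as (j' & Hj' & Mj).
    rewrite reg_dn, reg_up in Mj.
    (* Up to [i], [dn r] has rank at most [decs R i], too small for the value at [j0]; from [S i]
       on, monotonicity keeps it above that value. *)
    destruct (le_gt_dec j' i) as [Hle|Hgt].
    + pose proof (decs_mono R j' i Hle).
      destruct (G (decs R j')) as (k & Hk' & Ek); [lia|].
      rewrite (C j' k) in Mj by lia.
      apply (Irr (loc s k (up r))). rewrite <- Mj at 2. apply B; lia.
    + apply (dn_mono (S i) j'); [lia|]. rewrite <- Mj, Hjr. apply B; lia.
Qed.
End Soundness.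

(** * Soundness *)

Definition init (n : nat) : state := fun r => if r =? 0 then n else 0.

(** Time is the position in the model: the input is loaded into register 0 by one increment at each
    of the first [n] positions, and the machine starts at position [n]. *)
Definition conf (P : list instr) (n i : nat) : nat * state :=
  if i <? n then (0, init i) else Nat.iter (i - n) (step P) (0, init n).

Definition reg (P : list instr) (n r i : nat) : nat := snd (conf P n i) r.

Lemma conf_run P n k : conf P n (n + k) = Nat.iter k (step P) (0, init n).
Proof.
  unfold conf. destruct (Nat.ltb_spec (n + k) n); [lia|]. f_equal. lia.
Qed.

Lemma conf_step P n i : n <= i -> conf P n (S i) = step P (conf P n i).
Proof.
  intros H. replace i with (n + (i - n)) by lia.
  now rewrite <- Nat.add_succ_r, !conf_run.
Qed.

Lemma conf_load P n i : i <= n -> conf P n i = (0, init i).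
Proof.
  intros H. destruct (Nat.eq_dec i n) as [->|Hne].
  - replace n with (n + 0) at 2 by lia. now rewrite conf_run.
  - unfold conf. destruct (Nat.ltb_spec i n); [reflexivity|lia].
Qed.

Lemma reg_0 P n r : reg P n r 0 = 0.
Proof. unfold reg. rewrite conf_load by lia. cbn. unfold init. now destruct (r =? 0). Qed.

Lemma reg_load P n r i :
  i < n -> changes (only Up 0 r) (reg P n r i) (reg P n r (S i)).
Proof.
  intros H. unfold reg. rewrite !conf_load by lia. cbn. unfold init, only.
  now destruct (r =? 0).
Qed.

Lemma upd_Up s r r' : changes (only Up r r') (s r') (upd s r (S (s r)) r').
Proof.
  unfold upd, only. destruct (Nat.eqb_spec r' r) as [->|]; reflexivity.
Qed.

Lemma upd_Down s r r' : s r <> 0 -> changes (only Down r r') (s r') (upd s r (pred (s r)) r').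
Proof.
  intros H. unfold upd, only.
  destruct (Nat.eqb_spec r' r) as [->|]; cbn; [lia|reflexivity].
Qed.

Lemma step_le P c r : snd (step P c) r <= S (snd c r).
Proof.
  destruct c as [q s]. cbn. destruct (nth_error P q) as [[r'|r' l|l]|]; cbn; try lia.
  - unfold upd. destruct (Nat.eqb_spec r r') as [->|]; lia.
  - destruct (s r' =? 0); cbn; [lia|]. unfold upd.
    destruct (Nat.eqb_spec r r') as [->|]; lia.
Qed.

Lemma reg_S_le P n r i : reg P n r (S i) <= S (reg P n r i).
Proof.
  destruct (le_gt_dec n i) as [H|H].
  - unfold reg. rewrite conf_step by assumption. apply step_le.
  - pose proof (reg_load P n r i H) as C. revert C.
    unfold only. destruct (r =? 0); cbn; lia.
Qed.

Lemma halt_stays P n j k :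
  n <= j -> nth_error P (fst (conf P n j)) = None -> j <= k -> conf P n k = conf P n j.
Proof.
  intros Hn H. induction 1 as [|k Hk IH]; [reflexivity|].
  rewrite conf_step, IH by lia. destruct (conf P n j) as [q s]. cbn in *.
  now rewrite H.
Qed.

Lemma least (Q : nat -> Prop) k : Q k -> exists j, Q j /\ forall i, i < j -> ~ Q i.
Proof.
  induction k as [k IH] using lt_wf_ind. intros H.
  destruct (classic (exists i, i < k /\ Q i)) as [(i & Hi & Hq)|N]; [eauto|].
  exists k. split; [exact H|]. intros i Hi Hq. apply N. eauto.
Qed.

(** Once the zero test in the model agrees with the state, the formula of an instruction amounts to
    the [goto] for the actual machine step. Soundness uses the equivalence from left to right,
    completeness from right to left. *)
Lemma instr_form_step {D : Type} (lt : D -> D -> Prop) m i rs P q c (s : state) :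
  nth_error P q = Some c ->
  (forall r l, c = DEC r l -> (holds lt m i (zero r) <-> s r = 0)) ->
  exists op,
    (holds lt m i (instr_form rs q c) <->
     holds lt m i (goto rs (fst (step P (q, s))) op)) /\
    forall r, changes (op r) (s r) (snd (step P (q, s)) r).
Proof.
  intros Hc Hz. cbn [step]. rewrite Hc. destruct c as [r|r l|l]; cbn [instr_form].
  - exists (only Up r). split; [reflexivity|]. intros r'. apply upd_Up.
  - specialize (Hz r l eq_refl).
    destruct (Nat.eqb_spec (s r) 0) as [E|E].
    + exists (fun _ => Keep). split; [rewrite holds_FAnd, !holds_FImp; cbn [fst holds] in *; tauto|]. reflexivity.
    + exists (only Down r). split; [rewrite holds_FAnd, !holds_FImp; cbn [fst holds] in *; tauto|].
      intros r'. now apply upd_Down.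
  - exists (fun _ => Keep). split; reflexivity.
Qed.

Section Soundness.
Context {D : Type} (lt : D -> D -> Prop) (Hlt : strict_total_order lt).

Lemma base_const (s : model D) :
  (forall i, holds lt s i (LocEqX base 1 base)) -> forall i, loc s i base = loc s 0 base.
Proof.
  intros H. induction i as [|i IH]; [reflexivity|].
  rewrite <- IH. specialize (H i). cbn in H. rewrite Nat.add_1_r in H. now symmetry.
Qed.

(** The model is forced to follow the run up to the first halting position, where [halt_form]
    excludes output zero. *)
Lemma run_form_sound P out n k st :
  Nat.iter k (step P) (0, init n) = (length P, st) ->
  satisfiable lt (FAnd (run_form P out) (input_form n)) -> st out <> 0.
Proof.
  intros Hrun (s & Hs & Hin). unfold run_form in Hs. cbv zeta in Hs.
  set (rs := 0 :: out :: regs P) in *.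
  destruct Hs as (H0 & HG & j & _ & (Hm & Hn & Hl & HP) & Hload).
  rewrite holds_FAll in H0.
  rewrite holds_FAlways in HG. rewrite holds_FNext, holds_FAlways in Hn.
  rewrite holds_FAlways in HP.
  assert (HB := base_const s (fun i => proj1 (HG i (Nat.le_0_l i)))).
  assert (HR : forall r, In r rs -> forall i, holds lt s i (reg_form r)).
  { intros r Hr i. destruct (HG i (Nat.le_0_l i)) as [_ X].
    rewrite holds_FAll in X. auto. }
  assert (Hmn : holds lt s n marked).
  { cbn in *. rewrite Nat.add_0_r, HB. exact Hin. }
  (* The until formula forbids marks before its witness [j] and the next conjunct forbids them after
     it, whereas the input formula puts one at [n]. *)
  assert (j = n) as ->.
  { destruct (lt_eq_lt_dec j n) as [[L|E]|L]; [|exact E|]; exfalso.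
    - exact (Hn n L Hmn).
    - destruct (Hload n (Nat.le_0_l n) L) as [X _]. exact (X Hmn). }
  assert (Hreg : forall P r l q, nth_error P q = Some (DEC r l) -> In r (regs P)).
  { clear. intros P r l q H. apply nth_error_In in H.
    exact (in_map (fun c => match c with INC r | DEC r _ => r | JMP _ => 0 end) _ _ H). }
  assert (INV : forall i,
    (forall i', n <= i' < i -> nth_error P (fst (conf P n i')) <> None) ->
    (forall r, In r rs -> faithful lt s (reg P n r) r i) /\
    (n <= i -> holds lt s i (LocEqX base 0 (lab (fst (conf P n i)))))).
  { induction i as [|i IH]; intros Hi.
    - split.
      + intros r Hr. assert (E := H0 r Hr). cbn in E.
        repeat split; intros a b Ha Hb;
          replace a with 0 by lia; replace b with 0 by lia; cbn; auto; lia.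
      + intros Hn0. rewrite conf_load by lia. replace 0 with n at 1 by lia. exact Hl.
    - destruct IH as [IHr IHq]; [intros; apply Hi; lia|].
      destruct (le_gt_dec n i) as [Hni|Hni].
      + specialize (IHq Hni).
        assert (Hsome := Hi i (conj Hni (Nat.lt_succ_diag_r i))).
        destruct (nth_error P (fst (conf P n i))) as [c|] eqn:Hc; [clear Hsome|easy].
        destruct (instr_form_step lt s i rs P _ c (snd (conf P n i)) Hc)
          as (op & Hop & Hch).
        { intros r l ->. fold (reg P n r i).
          apply faithful_zero; auto using reg_0, reg_S_le.
          apply IHr. right. right. eapply Hreg; eauto. }
        rewrite <- surjective_pairing, <- conf_step in Hop, Hch by assumption.
        destruct (HP i Hni) as [Hprog _]. rewrite holds_prog_form in Hprog.
        apply (Hprog _ _ Hc) in IHq. apply Hop, holds_goto in IHq as [Hq Hg].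
        split; [|auto].
        intros r Hr. eapply faithful_step; eauto using reg_0, reg_S_le.
      + split.
        * intros r Hr. destruct (Hload i (Nat.le_0_l i) Hni) as [_ X].
          rewrite holds_FAll in X.
          eapply faithful_step; eauto using reg_0, reg_S_le.
          now apply reg_load.
        * intros Hn'. rewrite conf_load by lia. replace (S i) with n by lia. exact Hl. }
  (* The invariant reaches only the first halting position, since no instruction governs the model
     afterwards. Halted configurations are fixed, so the state there is already [st]. *)
  destruct (least (fun i => n <= i /\ nth_error P (fst (conf P n i)) = None) (n + k))
    as (i & (Hni & Hi) & Hmin).
  { split; [lia|]. rewrite conf_run, Hrun. now apply nth_error_None. }
  destruct (INV i) as [Ir Iq].
  { intros i' Hi' E. apply (Hmin i'); [lia|]. split; [lia|exact E]. }
  specialize (Iq Hni).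
  assert (E : conf P n i = (length P, st)).
  { rewrite <- Hrun, <- conf_run. symmetry. apply halt_stays; auto.
    apply Nat.nlt_ge. intros L.
    apply (Hmin (n + k) L). split; [lia|]. rewrite conf_run, Hrun. now apply nth_error_None. }
  rewrite E in Iq. destruct (HP i Hni) as [_ Hh]. unfold halt_form in Hh.
  rewrite holds_FImp in Hh. specialize (Hh Iq). intros Z. apply Hh.
  apply (faithful_zero lt Hlt s (reg P n out)); auto using reg_0, reg_S_le.
  - apply Ir. right. now left.
  - unfold reg. now rewrite E.
Qed.
End Soundness.

(** * Completeness *)

Lemma sorted_insert {D : Type} (lt : D -> D -> Prop) x l :
  strict_total_order lt -> StronglySorted lt l -> ~ In x l ->
  exists l', StronglySorted lt l' /\ length l' = S (length l) /\
    forall y, In y l' <-> y = x \/ In y l.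
Proof.
  intros (_ & Tr & Tot). induction 1 as [|a l Hs IH Ha]; intros Hx.
  - exists [x]. split; [repeat constructor|]. split; [reflexivity|].
    cbn. intros y. intuition auto.
  - destruct (Tot x a) as [L|[->|L]].
    + exists (x :: a :: l). split; [|split; [reflexivity|cbn; intuition auto]].
      constructor; [now constructor|]. constructor; [exact L|].
      eapply Forall_impl; [|exact Ha]. cbn. eauto.
    + destruct Hx. now left.
    + destruct IH as (l' & S' & L' & I'); [intros H; apply Hx; now right|].
      exists (a :: l'). split; [|split; [cbn; now rewrite L'|]].
      * constructor; [exact S'|]. apply Forall_forall. intros y Hy.
        apply I' in Hy as [->|Hy]; [exact L|]. rewrite Forall_forall in Ha. auto.
      * intros y. cbn. rewrite I'. intuition auto.
Qed.

(** An infinite increasing sequence need not exist (take the negative integers), but fresh elements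
    inserted into sorted lists give chains of every finite length. *)
Lemma increasing_chain {D : Type} (lt : D -> D -> Prop) :
  infinite_type D -> strict_total_order lt ->
  forall N, exists e : nat -> D, forall i j, i < j -> j <= N -> lt (e i) (e j).
Proof.
  intros Hinf Hlt N.
  assert (Hfresh : forall l : list D, exists d, ~ In d l).
  { intros l. apply NNPP. intros H. apply Hinf. exists l. intros d.
    apply NNPP. intros Hd. apply H. now exists d. }
  assert (H : exists l, StronglySorted lt l /\ length l = S N).
  { induction (S N) as [|m (l & Hs & Hl)].
    - exists []. split; [constructor|reflexivity].
    - destruct (Hfresh l) as (d & Hd).
      destruct (sorted_insert lt d l Hlt Hs Hd) as (l' & Hs' & Hl' & _).
      exists l'. split; [exact Hs'|congruence]. }
  destruct H as (l & Hs & Hl). destruct (Hfresh []) as (d0 & _).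
  exists (fun i => nth i l d0).
  assert (Hj : forall j, j <= N -> j < length l) by (intros; lia). clear Hl.
  intros i j Hij HjN. specialize (Hj j HjN). clear HjN.
  revert i j Hij Hj. induction Hs as [|a l Hs IH Ha]; intros i j Hij Hj; cbn in Hj; [lia|].
  destruct j as [|j]; [lia|]. destruct i as [|i]; cbn.
  - rewrite Forall_forall in Ha. apply Ha, nth_In. lia.
  - apply IH; lia.
Qed.

(** * The model of a halting run *)

Section Completeness.
Context {D : Type} (lt : D -> D -> Prop) (Hlt : strict_total_order lt).
Context (P : list instr) (n k out : nat) (st : state).
Context (Hrun : Nat.iter k (step P) (0, init n) = (length P, st)) (Hout : st out <> 0).
Context (e : nat -> D)
        (He : forall i j, i < j -> j <= S (n + k) -> lt (e i) (e j)).

(** The residue modulo 4 recovers the family of the variable. A rank [m] is realised by [e m]; for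
    labels and the mark, [e 0], the value of [base], means active and [e 1] inactive. *)
Definition run_value (i x : nat) : D :=
  let r := x / 4 in
  match x mod 4 with
  | 0 => e (incs (reg P n r) i)
  | 1 => e (decs (reg P n r) i)
  | 2 => e (if fst (conf P n i) =? r then 0 else 1)
  | _ => e (if r =? 0 then 0 else if i =? n then 0 else 1)
  end.

Definition run_model : model D := Model D run_value run_value.

Lemma run_value_tag i r t : t < 4 ->
  run_value i (4 * r + t) =
  match t with
  | 0 => e (incs (reg P n r) i)
  | 1 => e (decs (reg P n r) i)
  | 2 => e (if fst (conf P n i) =? r then 0 else 1)
  | _ => e (if r =? 0 then 0 else if i =? n then 0 else 1)
  end.
Proof.
  intros Ht. unfold run_value.
  rewrite <- (Nat.div_unique (4 * r + t) 4 r t Ht eq_refl).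
  now rewrite <- (Nat.mod_unique (4 * r + t) 4 r t Ht eq_refl).
Qed.

Lemma value_up i r : run_value i (up r) = e (incs (reg P n r) i).
Proof. unfold up. rewrite <- (Nat.add_0_r (4 * r)). apply run_value_tag. lia. Qed.

Lemma value_dn i r : run_value i (dn r) = e (decs (reg P n r) i).
Proof. apply run_value_tag. lia. Qed.

Lemma value_lab i q : run_value i (lab q) = e (if fst (conf P n i) =? q then 0 else 1).
Proof. apply run_value_tag. lia. Qed.

Lemma value_base i : run_value i base = e 0.
Proof. apply (run_value_tag i 0 3). lia. Qed.

Lemma value_mark i : run_value i mark = e (if i =? n then 0 else 1).
Proof. apply (run_value_tag i 1 3). lia. Qed.

Lemma e_inj i j : i <= S (n + k) -> j <= S (n + k) -> e i = e j -> i = j.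
Proof.
  intros Hi Hj E. destruct (lt_eq_lt_dec i j) as [[L|Eq]|L]; [|exact Eq|];
    exfalso; apply He in L; auto; rewrite E in L; now apply Hlt in L.
Qed.

Lemma conf_end i : n + k <= i -> conf P n i = (length P, st).
Proof.
  intros Hi. rewrite <- Hrun, <- conf_run. apply halt_stays; [lia| |exact Hi].
  rewrite conf_run, Hrun. now apply nth_error_None.
Qed.

(** At most one increment happens per position, and none from position [n + k] on, where the machine
    has halted. *)
Lemma incs_bound r i : incs (reg P n r) i <= n + k.
Proof.
  assert (H : incs (reg P n r) i <= min i (n + k)); [|lia].
  induction i as [|i IH]; [cbn; lia|]. cbn [incs].
  pose proof (reg_S_le P n r i).
  destruct (le_gt_dec (n + k) i) as [L|L]; [|lia].
  unfold reg in *. rewrite (conf_end i), (conf_end (S i)) in * by lia. lia.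
Qed.

Lemma decs_le_incs r i : decs (reg P n r) i <= incs (reg P n r) i.
Proof. rewrite (incs_decs (reg P n r) i) by apply reg_0. lia. Qed.

Lemma decs_bound r i : decs (reg P n r) i <= n + k.
Proof. pose proof (decs_le_incs r i). pose proof (incs_bound r i). lia. Qed.

Lemma incs_hits r i m : m <= incs (reg P n r) i -> exists j, j <= i /\ incs (reg P n r) j = m.
Proof.
  intros H. destruct (small_steps (incs (reg P n r)) 0 i m) as (j & Hj & E).
  - lia.
  - intros j _. cbn. pose proof (reg_S_le P n r j). lia.
  - cbn. lia.
  - exists j. split; [lia|exact E].
Qed.

Lemma step_pred P' c r : snd c r <= S (snd (step P' c) r).
Proof.
  destruct c as [q s]. cbn. destruct (nth_error P' q) as [[r'|r' l|l]|]; cbn; try lia.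
  - unfold upd. destruct (Nat.eqb_spec r r') as [->|]; lia.
  - destruct (s r' =? 0); cbn; [lia|]. unfold upd.
    destruct (Nat.eqb_spec r r') as [->|]; lia.
Qed.

Lemma reg_le_S r i : reg P n r i <= S (reg P n r (S i)).
Proof.
  destruct (le_gt_dec n i) as [H|H].
  - unfold reg. rewrite conf_step by assumption. apply step_pred.
  - pose proof (reg_load P n r i H) as C. revert C.
    unfold only. destruct (r =? 0); cbn; lia.
Qed.

Lemma model_chg c r i :
  changes c (reg P n r i) (reg P n r (S i)) -> holds lt run_model i (chg c r).
Proof.
  pose proof (incs_bound r (S i)). pose proof (decs_bound r (S i)).
  pose proof (decs_le_incs r (S i)).
  intros Hc. destruct c; cbn in Hc |- *;
    rewrite ?Nat.add_1_r, ?value_up, ?value_dn in *; cbn in *.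
  - split; f_equal; lia.
  - split; [apply He; lia|f_equal; lia].
  - split; [f_equal; lia|]. split; [apply He; lia|].
    (* The new rank of [dn r] does not exceed that of [up r], so [up r] has passed through it. *)
    destruct (incs_hits r i (decs (reg P n r) (S i))) as (j & Hj & E); [cbn; lia|].
    exists j. split; [lia|]. rewrite value_up, E. reflexivity.
Qed.

(** For the backward closure: [decs] moves in unit steps, so on its way to the rank of [up r] at
    [S i] it meets the rank of [up r] at [i], and does so after position [i]. *)
Lemma model_reg r i : holds lt run_model i (reg_form r).
Proof.
  unfold reg_form. rewrite !holds_FAnd, holds_FOr, holds_FImp, holds_FNext.
  cbn [holds loc rem run_model matched]. repeat split.
  - rewrite Nat.add_1_r, !value_dn.
    pose proof (decs_bound r (S i)). pose proof (decs_mono (reg P n r) i (S i)).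
    destruct (Nat.eq_dec (decs (reg P n r) i) (decs (reg P n r) (S i))) as [->|].
    + now left.
    + right. apply He; lia.
  - intros (j & Hj & E). rewrite value_up, value_dn in E.
    pose proof (incs_bound r (S i)). pose proof (decs_bound r j).
    apply e_inj in E; [|lia|lia].
    destruct (small_steps (decs (reg P n r)) (S i) j (incs (reg P n r) i))
      as (j' & Hj' & E').
    + lia.
    + intros m _. cbn. pose proof (reg_le_S r m). lia.
    + pose proof (incs_mono (reg P n r) i (S i)).
      pose proof (decs_le_incs r i). pose proof (incs_decs (reg P n r) i (reg_0 P n r)).
      cbn [decs incs] in *. lia.
    + exists j'. split; [lia|]. rewrite value_up, value_dn, E'. reflexivity.
Qed.

Lemma model_zero r i : holds lt run_model i (zero r) <-> reg P n r i = 0.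
Proof.
  cbn. rewrite Nat.add_0_r, value_up, value_dn.
  pose proof (incs_bound r i). pose proof (decs_bound r i).
  pose proof (incs_decs (reg P n r) i (reg_0 P n r)).
  split; [intros E; apply e_inj in E; lia|intros E; f_equal; lia].
Qed.

Lemma model_lab q i :
  holds lt run_model i (LocEqX base 0 (lab q)) <-> fst (conf P n i) = q.
Proof.
  cbn. rewrite Nat.add_0_r, value_base, value_lab.
  destruct (Nat.eqb_spec (fst (conf P n i)) q) as [E|E]; [tauto|].
  split; [|tauto]. intros H. apply e_inj in H; lia.
Qed.

Lemma model_marked i : holds lt run_model i marked <-> i = n.
Proof.
  cbn. rewrite Nat.add_0_r, value_base, value_mark.
  destruct (Nat.eqb_spec i n) as [E|E]; [tauto|].
  split; [|tauto]. intros H. apply e_inj in H; lia.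
Qed.

Lemma run_model_correct : holds lt run_model 0 (FAnd (run_form P out) (input_form n)).
Proof.
  unfold run_form. cbv zeta. set (rs := 0 :: out :: regs P).
  rewrite !holds_FAnd, holds_FAll, holds_FAlways. split; [split; [|split]|].
  - intros r _. apply model_zero, reg_0.
  - intros i _. rewrite holds_FAnd, holds_FAll. split.
    + cbn. now rewrite !value_base.
    + intros r _. apply model_reg.
  - exists n. split; [lia|]. split.
    + rewrite !holds_FAnd, holds_FNext, !holds_FAlways, model_marked, model_lab.
      split; [reflexivity|]. split; [|split].
      * intros i Hi. change (~ holds lt run_model i marked).
        rewrite model_marked. lia.
      * now rewrite conf_load by lia.
      * intros i Hi. split.
        -- rewrite holds_prog_form. intros q c Hc Hq. apply model_lab in Hq.
           destruct (instr_form_step lt run_model i rs P q c (snd (conf P n i)) Hc)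
             as (op & Hop & Hch).
           { intros r l _. apply model_zero. }
           rewrite <- Hq, <- surjective_pairing, <- conf_step in Hop, Hch by assumption.
           rewrite Hq in Hop. apply Hop, holds_goto. split.
           ++ now apply model_lab.
           ++ intros r _. apply model_chg. apply Hch.
        -- unfold halt_form. rewrite holds_FImp, model_lab. intros Hq.
           change (~ holds lt run_model i (zero out)). rewrite model_zero.
           (* A position with the halting label lies on the constant tail of the run, hence has the
              same configuration as [max i (n + k)]. *)
           assert (E : conf P n i = (length P, st)).
           { rewrite <- (conf_end (max i (n + k))) by lia. symmetry.
             apply halt_stays; [exact Hi| |lia]. rewrite Hq. now apply nth_error_None. }
           unfold reg. now rewrite E.
    + intros i _ Hi. rewrite holds_FAnd, holds_FAll. split.
      * change (~ holds lt run_model i marked). rewrite model_marked. lia.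
      * intros r _. apply model_chg. now apply reg_load.
  - cbn. now rewrite value_base, value_mark, Nat.eqb_refl.
Qed.
End Completeness.

(** * The diagonal formula *)

Fixpoint const (m : nat) : prf :=
  match m with
  | 0 => PZero
  | S m => PComp PSucc [const m]
  end.

Definition add_prf : prf := PRec (PProj 0) (PComp PSucc [PProj 1]).

(** Triangular numbers by their recurrence, which avoids computing the division in [cpair]. *)
Definition tri_prf : prf :=
  PRec PZero (PComp PSucc [PComp add_prf [PProj 0; PProj 1]]).

Definition cpair_prf : prf := PComp add_prf [PComp tri_prf [add_prf]; PProj 1].

Lemma eval_const m xs : eval (const m) xs m.
Proof.
  induction m; cbn; [constructor|]. econstructor; repeat constructor. eassumption.
Qed.

Lemma eval_add a b : eval add_prf [a; b] (a + b).
Proof.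
  induction a as [|a IH].
  - constructor. apply (evProj 0 [b]). cbn. lia.
  - econstructor; [exact IH|].
    apply evComp with [a + b]; [|constructor].
    repeat constructor.
Qed.

Lemma eval_comp2 f g h xs a b y :
  eval g xs a -> eval h xs b -> eval f [a; b] y -> eval (PComp f [g; h]) xs y.
Proof. intros. apply evComp with [a; b]; [repeat constructor|]; assumption. Qed.

Lemma eval_tri m : eval tri_prf [m] (m * (m + 1) / 2).
Proof.
  induction m as [|m IH].
  - constructor. constructor.
  - econstructor; [exact IH|].
    replace (S m * (S m + 1) / 2) with (S (m + m * (m + 1) / 2)).
    2:{ replace (S m * (S m + 1)) with (m * (m + 1) + (m + 1) * 2) by lia.
        rewrite Nat.div_add by lia. lia. }
    apply evComp with [m + m * (m + 1) / 2]; [|constructor].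
    repeat constructor. eapply eval_comp2; [| |apply eval_add].
    + apply (evProj 0 [m; m * (m + 1) / 2]). cbn. lia.
    + apply (evProj 1 [m; m * (m + 1) / 2]). cbn. lia.
Qed.

Lemma eval_cpair a b : eval cpair_prf [a; b] (cpair a b).
Proof.
  unfold cpair_prf, cpair. eapply eval_comp2; [| |apply eval_add].
  - apply evComp with [a + b]; [|apply eval_tri]. repeat constructor. apply eval_add.
  - apply (evProj 1 [a; b]). cbn. lia.
Qed.

(** Tag 6 is that of [FAnd] and tag 0 that of [LocEqX]. The argument occurs twice: as the code of
    the left conjunct and as the input number in the right one. *)
Definition diag_prf : prf :=
  PComp cpair_prf [const 6; PComp cpair_prf [PProj 0;
    PComp cpair_prf [const 0; PComp cpair_prf [const base;
      PComp cpair_prf [PProj 0; const mark]]]]].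

Lemma eval_diag f : eval diag_prf [enc f] (enc (FAnd f (input_form (enc f)))).
Proof.
  assert (H : eval (PProj 0) [enc f] (enc f)) by (apply (evProj 0 [enc f]); cbn; lia).
  cbn [enc input_form].
  repeat (eapply eval_comp2; [apply eval_const || exact H| |apply eval_cpair]);
    apply eval_const || exact H.
Qed.

(** Input in register 0 and output in register 1; with no code on either side, the final label is
    [length P], the one that [halt_form] tests. *)
Lemma machine_of_prf h m v : let P := flat (comp h [0] 1) 0 in
  eval h [m] v ->
  exists k st, Nat.iter k (step P) (0, init m) = (length P, st) /\ st 1 = v.
Proof.
  intros P Hv. destruct (comp_correct h [0] 1 (init m) v) as (st & E & V & _).
  - repeat constructor.
  - exact Hv.
  - destruct (flat_exec _ _ _ E [] []) as (k & Hk). cbn [length app Nat.add] in Hk.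
    rewrite app_nil_r in Hk. exists k, st. split; [exact Hk|exact V].
Qed.

Theorem theorem3p2p1 (D : Type) (lt : D -> D -> Prop) :
  infinite_type D -> strict_total_order lt ->
  ~ decidable_form (satisfiable lt).
Proof.
  intros Hinf Hlt (c & Hc).
  (* The program does not mention its input, so [phi] can be built from it and its code supplied as
     the input afterwards. *)
  set (P := flat (comp (PComp c [diag_prf]) [0] 1) 0).
  set (phi := run_form P 1).
  pose proof (eval_diag phi) as Hdiag.
  assert (Hrun : forall v, eval c [enc (FAnd phi (input_form (enc phi)))] v ->
    exists k st, Nat.iter k (step P) (0, init (enc phi)) = (length P, st) /\ st 1 = v).
  { intros v Hv. apply machine_of_prf. eapply evComp; [|exact Hv].
    constructor; [exact Hdiag|constructor]. }
  clearbody P. revert Hrun. generalize (enc phi) as n. intros n Hrun.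
  destruct (Hc (FAnd phi (input_form n))) as [H0 H1].
  (* If the formula were satisfiable, the machine would halt with output 0, against soundness. The
     answer is therefore 1, and that halting run yields a model after all. *)
  assert (N : ~ satisfiable lt (FAnd phi (input_form n))).
  { intros Hs. destruct (Hrun 0 (H0 Hs)) as (k & st & Hk & Hst).
    exact (run_form_sound lt Hlt P 1 n k st Hk Hs Hst). }
  destruct (Hrun 1 (H1 N)) as (k & st & Hk & Hst).
  (* Ranks go up to [n + k]; the successor keeps [e 0] and [e 1] distinct even if [n + k] is
     zero. *)
  destruct (increasing_chain lt Hinf Hlt (S (n + k))) as (e & He).
  apply N. exists (run_model P n e).
  apply (run_model_correct lt Hlt P n k 1 st Hk); [lia|exact He].
Qed.
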